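(* Let $\mathcal{X}$ and $\mathcal{C}$ be monoidal categories. Let there be a strong action of $\mathcal{X}$ on $\mathcal{C}$. Then the semidirect product $\mathcal{X} \ltimes \mathcal{C}$ is a monoidal category.
   Context: In a monoidal category the structure isomorphisms are directed as $\alpha_{A,B,C} \colon A \otimes (B \otimes C) \to (A \otimes B) \otimes C$, $\lambda_A \colon A \to \mathcal{I} \otimes A$, $\rho_A \colon A \otimes \mathcal{I} \to A$. An object's name also denotes its identity morphism. Strong action of $\mathcal{X}$ on $\mathcal{C}$: a strong monoidal functor $\Gamma$ from $\mathcal{X}$ to $[\mathcal{C},\mathcal{C}]$, the strict monoidal category of strong monoidal endofunctors of $\mathcal{C}$ and monoidal natural transformations, with tensor product given by functor composition in diagrammatic order. For an object $X$ (morphism $f$) of $\mathcal{X}$, write $(-)^X$ (respectively $(-)^f$) for $\Gamma(X)$ (respectively $\Gamma(f)$). The structure isomorphisms of the strong monoidal functor $(-)^X$ are $\varphi^X_{B,C} \colon B^X \otimes C^X \to (B \otimes C)^X$ and $\varphi^X \colon \mathcal{I}_{\mathcal{C}} \to \mathcal{I}_{\mathcal{C}}^X$. The structure isomorphisms of $\Gamma$, in the oplax direction, are monoidal natural isomorphisms with components $\psi^{X,Y}_C \colon C^{X \otimes Y} \to (C^X)^Y$ and $\psi_C \colon C^{\mathcal{I}_{\mathcal{X}}} \to C$. Semidirect product $\mathcal{X} \ltimes \mathcal{C}$: the underlying category is $\mathcal{X} \times \mathcal{C}$, with objects written $\langle X, C \rangle$. The tensor product is $\langle X, B \rangle \otimes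 \langle Y, C \rangle = \langle X \otimes Y, B^Y \otimes C \rangle$ (and correspondingly on morphisms) and the unit is $\langle \mathcal{I}_{\mathcal{X}}, \mathcal{I}_{\mathcal{C}} \rangle$. The structure maps are given by their components in $\mathcal{X}$ and in $\mathcal{C}$. Their $\mathcal{X}$-components are the structure maps $\alpha_{X,Y,Z}$, $\lambda_X$, $\rho_X$ of $\mathcal{X}$. Their $\mathcal{C}$-components are: for $\alpha_{\langle X,A \rangle, \langle Y,B \rangle, \langle Z,C \rangle}$, the composite $(\varphi^Z_{A^Y,B} \otimes C) \circ \alpha_{(A^Y)^Z,B^Z,C} \circ (\psi^{Y,Z}_A \otimes (B^Z \otimes C)) \colon A^{Y \otimes Z} \otimes (B^Z \otimes C) \to (A^Y \otimes B)^Z \otimes C$; for $\lambda_{\langle X,C \rangle}$, the composite $(\varphi^X \otimes C) \circ \lambda_C \colon C \to \mathcal{I}_{\mathcal{C}}^X \otimes C$; for $\rho_{\langle X,C \rangle}$, the composite $\rho_C \circ (\psi_C \otimes \mathcal{I}_{\mathcal{C}}) \colon C^{\mathcal{I}_{\mathcal{X}}} \otimes \mathcal{I}_{\mathcal{C}} \to C$. *)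

(* Defs.v *)
From Stdlib Require Import ssreflect FunctionalExtensionality ProofIrrelevance.

Set Implicit Arguments.
Unset Strict Implicit.
Unset Printing Implicit Defensive.

Declare Scope cat_scope.
Delimit Scope cat_scope with cat.
Local Open Scope cat_scope.

Reserved Notation "A ~> B" (at level 70, no associativity).
Reserved Notation "g ∘ f" (at level 50, left associativity).
Reserved Notation "A ⊗ B" (at level 40, left associativity).
Reserved Notation "f ⊗₁ g" (at level 40, left associativity).

Record category := Category {
  ob :> Type;
  hom : ob -> ob -> Type;
  idm : forall A, hom A A;
  comp : forall A B C, hom B C -> hom A B -> hom A C;
  comp_idl : forall A B (f : hom A B), comp (idm B) f = f;
  comp_idr : forall A B (f : hom A B), comp f (idm A) = f;
  comp_assoc : forall A B C D (h : hom C D) (g : hom B C) (f : hom A B),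
    comp h (comp g f) = comp (comp h g) f }.

Arguments hom {c} A B.
Arguments idm {c} A.
Arguments comp {c A B C} g f.
Notation "A ~> B" := (hom A B) : cat_scope.
Notation "g ∘ f" := (comp g f) : cat_scope.

Definition inverse (C : category) (A B : C) (f : A ~> B) (g : B ~> A) : Prop :=
  g ∘ f = idm A /\ f ∘ g = idm B.

Definition is_iso (C : category) (A B : C) (f : A ~> B) : Prop :=
  exists g : B ~> A, inverse f g.

(* No axioms are imposed here; see [is_monoidal]. *)
Record mon_data := MonData {
  md_cat :> category;
  tob : md_cat -> md_cat -> md_cat;
  tmor : forall A A' B B' : md_cat,
    A ~> A' -> B ~> B' -> tob A B ~> tob A' B';
  tunit : md_cat;
  alpha : forall A B C : md_cat, tob A (tob B C) ~> tob (tob A B) C;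
  lam : forall A : md_cat, A ~> tob tunit A;
  rho : forall A : md_cat, tob A tunit ~> A }.

Arguments tob {m} A B.
Arguments tmor {m A A' B B'} f g.
Arguments tunit m : clear implicits.
Arguments alpha {m} A B C.
Arguments lam {m} A.
Arguments rho {m} A.
Notation "A ⊗ B" := (tob A B) : cat_scope.
Notation "f ⊗₁ g" := (tmor f g) : cat_scope.

Record is_monoidal (M : mon_data) : Prop := IsMonoidal {
  tensor_id : forall A B : M, idm A ⊗₁ idm B = idm (A ⊗ B);
  tensor_comp : forall (A A' A'' B B' B'' : M)
      (f' : A' ~> A'') (f : A ~> A') (g' : B' ~> B'') (g : B ~> B'),
    (f' ∘ f) ⊗₁ (g' ∘ g) = (f' ⊗₁ g') ∘ (f ⊗₁ g);
  alpha_natural : forall (A A' B B' C C' : M)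
      (f : A ~> A') (g : B ~> B') (h : C ~> C'),
    alpha A' B' C' ∘ (f ⊗₁ (g ⊗₁ h)) = ((f ⊗₁ g) ⊗₁ h) ∘ alpha A B C;
  lam_natural : forall (A B : M) (f : A ~> B),
    lam B ∘ f = (idm (tunit M) ⊗₁ f) ∘ lam A;
  rho_natural : forall (A B : M) (f : A ~> B),
    rho B ∘ (f ⊗₁ idm (tunit M)) = f ∘ rho A;
  alpha_iso : forall A B C : M, is_iso (alpha A B C);
  lam_iso : forall A : M, is_iso (lam A);
  rho_iso : forall A : M, is_iso (rho A);
  pentagon : forall A B C D : M,
    alpha (A ⊗ B) C D ∘ alpha A B (C ⊗ D)
    = (alpha A B C ⊗₁ idm D) ∘ alpha A (B ⊗ C) D
        ∘ (idm A ⊗₁ alpha B C D);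
  triangle : forall A B : M,
    (rho A ⊗₁ idm B) ∘ alpha A (tunit M) B ∘ (idm A ⊗₁ lam B)
    = idm (A ⊗ B) }.

Record monoidal_category := MonoidalCategory {
  mc_data :> mon_data;
  mc_monoidal : is_monoidal mc_data }.

Record functor (C D : category) := Functor {
  fob :> C -> D;
  fmap : forall A B : C, A ~> B -> fob A ~> fob B;
  fmap_id : forall A : C, fmap (idm A) = idm (fob A);
  fmap_comp : forall (A B E : C) (g : B ~> E) (f : A ~> B),
    fmap (g ∘ f) = fmap g ∘ fmap f }.

Arguments fmap {C D} _ {A B} _.

(* The inverses of the structure isomorphisms are part of the record. They are
   uniquely determined, so this adds no structure; it makes the oplax
   structure maps available as terms. *)
Record strong_functor (C D : monoidal_category) := StrongFunctor {
  sf_functor :> functor C D;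
  phi : forall A B : C, sf_functor A ⊗ sf_functor B ~> sf_functor (A ⊗ B);
  phi_inv : forall A B : C, sf_functor (A ⊗ B) ~> sf_functor A ⊗ sf_functor B;
  phi0 : tunit D ~> sf_functor (tunit C);
  phi0_inv : sf_functor (tunit C) ~> tunit D;
  phiK : forall A B : C, inverse (phi A B) (phi_inv A B);
  phi0K : inverse phi0 phi0_inv;
  phi_natural : forall (A A' B B' : C) (f : A ~> A') (g : B ~> B'),
    phi A' B' ∘ (fmap sf_functor f ⊗₁ fmap sf_functor g)
    = fmap sf_functor (f ⊗₁ g) ∘ phi A B;
  phi_alpha : forall A B E : C,
    fmap sf_functor (alpha A B E) ∘ phi A (B ⊗ E)
      ∘ (idm (sf_functor A) ⊗₁ phi B E)
    = phi (A ⊗ B) E ∘ (phi A B ⊗₁ idm (sf_functor E))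
        ∘ alpha (sf_functor A) (sf_functor B) (sf_functor E);
  phi_lam : forall A : C,
    phi (tunit C) A ∘ (phi0 ⊗₁ idm (sf_functor A)) ∘ lam (sf_functor A)
    = fmap sf_functor (lam A);
  phi_rho : forall A : C,
    fmap sf_functor (rho A) ∘ phi A (tunit C)
      ∘ (idm (sf_functor A) ⊗₁ phi0)
    = rho (sf_functor A) }.

Arguments phi {C D} s A B.
Arguments phi_inv {C D} s A B.
Arguments phi0 {C D} s.
Arguments phi0_inv {C D} s.

Record mon_nat (C D : monoidal_category) (F G : strong_functor C D) := MonNat {
  component :> forall A : C, F A ~> G A;
  component_natural : forall (A B : C) (f : A ~> B),
    component B ∘ fmap F f = fmap G f ∘ component A;
  component_phi : forall A B : C,
    component (A ⊗ B) ∘ phi F A B = phi G A B ∘ (component A ⊗₁ component B);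
  component_phi0 : component (tunit C) ∘ phi0 F = phi0 G }.

Lemma mon_nat_eq (C D : monoidal_category) (F G : strong_functor C D)
    (s t : mon_nat F G) : (forall A, s A = t A) -> s = t.
Proof.
case: s t => [s s1 s2 s3] [t t1 t2 t3] /= E.
have E' : s = t by apply: functional_extensionality_dep.
by subst t; f_equal; apply: proof_irrelevance.
Qed.

Section EndofunctorCategory.
Variable C : monoidal_category.

Definition mon_nat_id (F : strong_functor C C) : mon_nat F F.
Proof.
refine (@MonNat C C F F (fun A => idm (F A)) _ _ _).
- by move=> A B f; rewrite comp_idl comp_idr.
- by move=> A B; rewrite (tensor_id (mc_monoidal C)) comp_idl comp_idr.
- by rewrite comp_idl.
Defined.

Definition mon_nat_comp (F G H : strong_functor C C)
    (t : mon_nat G H) (s : mon_nat F G) : mon_nat F H.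
Proof.
refine (@MonNat C C F H (fun A => t A ∘ s A) _ _ _).
- move=> A B f; rewrite -comp_assoc component_natural comp_assoc.
  by rewrite component_natural comp_assoc.
- move=> A B; rewrite -comp_assoc component_phi comp_assoc component_phi.
  by rewrite (tensor_comp (mc_monoidal C)) comp_assoc.
- by rewrite -comp_assoc !component_phi0.
Defined.

Definition endo_cat : category.
Proof.
refine (@Category (strong_functor C C) (@mon_nat C C) mon_nat_id
  mon_nat_comp _ _ _).
- by move=> F G s; apply: mon_nat_eq => A /=; rewrite comp_idl.
- by move=> F G s; apply: mon_nat_eq => A /=; rewrite comp_idr.
- by move=> F G H K u t s; apply: mon_nat_eq => A /=; rewrite comp_assoc.
Defined.

Definition id_functor : functor C C :=
  @Functor C C (fun A => A) (fun _ _ f => f) (fun _ => eq_refl)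
    (fun _ _ _ _ _ => eq_refl).

(* Diagrammatic order: first F, then G. *)
Definition seq_functor (F G : functor C C) : functor C C.
Proof.
refine (@Functor C C (fun A => G (F A)) (fun A B f => fmap G (fmap F f)) _ _).
- by move=> A; rewrite !fmap_id.
- by move=> A B E g f; rewrite !fmap_comp.
Defined.

Definition id_strong : strong_functor C C.
Proof.
refine (@StrongFunctor C C id_functor
  (fun A B => idm (A ⊗ B)) (fun A B => idm (A ⊗ B))
  (idm (tunit C)) (idm (tunit C)) _ _ _ _ _ _);
  rewrite /inverse /=.
- by move=> A B; rewrite comp_idl.
- by rewrite comp_idl.
- by move=> A A' B B' f g; rewrite comp_idl comp_idr.
- by move=> A B E; rewrite !(tensor_id (mc_monoidal C)) !comp_idr !comp_idl.
- by move=> A; rewrite !(tensor_id (mc_monoidal C)) !comp_idl.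
- by move=> A; rewrite !(tensor_id (mc_monoidal C)) !comp_idr.
Defined.

Definition seq_strong (F G : strong_functor C C) : strong_functor C C.
Proof.
refine (@StrongFunctor C C (seq_functor F G)
  (fun A B => fmap G (phi F A B) ∘ phi G (F A) (F B))
  (fun A B => phi_inv G (F A) (F B) ∘ fmap G (phi_inv F A B))
  (fmap G (phi0 F) ∘ phi0 G)
  (phi0_inv G ∘ fmap G (phi0_inv F)) _ _ _ _ _ _).
- move=> A B; case: (phiK F A B) => F1 F2; case: (phiK G (F A) (F B)) => G1 G2.
  split=> /=.
    rewrite comp_assoc -(comp_assoc (phi_inv G _ _)) -fmap_comp F1 fmap_id.
    by rewrite comp_idr.
  rewrite comp_assoc -(comp_assoc (fmap G _)) G2 comp_idr -fmap_comp F2.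
  by rewrite fmap_id.
- case: (phi0K F) => F1 F2; case: (phi0K G) => G1 G2; split=> /=.
    rewrite comp_assoc -(comp_assoc (phi0_inv G)) -fmap_comp F1 fmap_id.
    by rewrite comp_idr.
  rewrite comp_assoc -(comp_assoc (fmap G _)) G2 comp_idr -fmap_comp F2.
  by rewrite fmap_id.
- move=> A A' B B' f g /=.
  by rewrite -comp_assoc phi_natural !comp_assoc -!fmap_comp phi_natural.
- move=> A B E /=.
  have E1 : idm (G (F A)) ⊗₁ (fmap G (phi F B E) ∘ phi G (F B) (F E))
     = (fmap G (idm (F A)) ⊗₁ fmap G (phi F B E))
         ∘ (idm (G (F A)) ⊗₁ phi G (F B) (F E)).
    by rewrite -(tensor_comp (mc_monoidal C)) fmap_id comp_idl.
  have E2 : (fmap G (phi F A B) ∘ phi G (F A) (F B)) ⊗₁ idm (G (F E))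
     = (fmap G (phi F A B) ⊗₁ fmap G (idm (F E)))
         ∘ (phi G (F A) (F B) ⊗₁ idm (G (F E))).
    by rewrite -(tensor_comp (mc_monoidal C)) fmap_id comp_idl.
  rewrite E1 E2 !comp_assoc -(comp_assoc _ (phi G (F A) (F (B ⊗ E)))).
  rewrite phi_natural -(comp_assoc _ (phi G (F (A ⊗ B)) (F E))) phi_natural.
  rewrite !comp_assoc -!fmap_comp phi_alpha !fmap_comp -!comp_assoc.
  by rewrite (comp_assoc (fmap G (alpha _ _ _))) phi_alpha -!comp_assoc.
- move=> A /=.
  have E1 : (fmap G (phi0 F) ∘ phi0 G) ⊗₁ idm (G (F A))
     = (fmap G (phi0 F) ⊗₁ fmap G (idm (F A))) ∘ (phi0 G ⊗₁ idm (G (F A))).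
    by rewrite -(tensor_comp (mc_monoidal C)) fmap_id comp_idl.
  rewrite E1 !comp_assoc -(comp_assoc _ (phi G _ _)) phi_natural.
  rewrite -!comp_assoc (comp_assoc (phi G _ _)) phi_lam -!fmap_comp.
  by rewrite comp_assoc phi_lam.
- move=> A /=.
  have E1 : idm (G (F A)) ⊗₁ (fmap G (phi0 F) ∘ phi0 G)
     = (fmap G (idm (F A)) ⊗₁ fmap G (phi0 F)) ∘ (idm (G (F A)) ⊗₁ phi0 G).
    by rewrite -(tensor_comp (mc_monoidal C)) fmap_id comp_idl.
  rewrite E1 !comp_assoc -(comp_assoc _ (phi G _ _)) phi_natural.
  by rewrite !comp_assoc -!fmap_comp phi_rho phi_rho.
Defined.

Definition mon_nat_seq (F F' G G' : strong_functor C C)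
    (s : mon_nat F F') (t : mon_nat G G') :
  mon_nat (seq_strong F G) (seq_strong F' G').
Proof.
refine (@MonNat C C (seq_strong F G) (seq_strong F' G')
  (fun A => t (F' A) ∘ fmap G (s A)) _ _ _) => /=.
- move=> A B f.
  rewrite -comp_assoc -fmap_comp (component_natural s) fmap_comp !comp_assoc.
  by rewrite (component_natural t).
- move=> A B.
  rewrite (tensor_comp (mc_monoidal C)) -!comp_assoc.
  rewrite (comp_assoc (fmap G _)) -fmap_comp (component_phi s) fmap_comp.
  rewrite -(comp_assoc (fmap G _)) -phi_natural !comp_assoc.
  rewrite (component_natural t) -(comp_assoc (fmap G' _)) (component_phi t).
  by rewrite !comp_assoc.
- rewrite -!comp_assoc (comp_assoc (fmap G _)) -fmap_comp (component_phi0 s).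
  by rewrite comp_assoc (component_natural t) -comp_assoc (component_phi0 t).
Defined.

Lemma seq_identity_phi (F G H : strong_functor C C) (A B : C) :
  phi (seq_strong (seq_strong F G) H) A B
  = phi (seq_strong F (seq_strong G H)) A B.
Proof. by rewrite /= fmap_comp comp_assoc. Qed.

Lemma seq_identity_phi0 (F G H : strong_functor C C) :
  phi0 (seq_strong (seq_strong F G) H) = phi0 (seq_strong F (seq_strong G H)).
Proof. by rewrite /= fmap_comp comp_assoc. Qed.

(* The monoidal structure of [C, C] is strict: its structure maps are
   identities. The two sides of each of them have the same underlying functor
   up to conversion, but their [phi] agree only propositionally, whence the
   componentwise definitions. *)
Definition endo_alpha (F G H : strong_functor C C) :
  mon_nat (seq_strong F (seq_strong G H)) (seq_strong (seq_strong F G) H).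
Proof.
refine (@MonNat C C (seq_strong F (seq_strong G H))
  (seq_strong (seq_strong F G) H) (fun A => idm (H (G (F A)))) _ _ _).
- by move=> A B f; rewrite comp_idl comp_idr.
- move=> A B; rewrite seq_identity_phi (tensor_id (mc_monoidal C)).
  by rewrite comp_idl comp_idr.
- by rewrite seq_identity_phi0 comp_idl.
Defined.

Definition endo_lam (F : strong_functor C C) :
  mon_nat F (seq_strong id_strong F).
Proof.
refine (@MonNat C C F (seq_strong id_strong F) (fun A => idm (F A)) _ _ _).
- by move=> A B f; rewrite comp_idl comp_idr.
- move=> A B; rewrite (tensor_id (mc_monoidal C)) /= fmap_id.
  by rewrite !comp_idl comp_idr.
- by rewrite /= fmap_id.
Defined.

Definition endo_rho (F : strong_functor C C) :
  mon_nat (seq_strong F id_strong) F.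
Proof.
refine (@MonNat C C (seq_strong F id_strong) F (fun A => idm (F A)) _ _ _).
- by move=> A B f; rewrite comp_idl comp_idr.
- by move=> A B; rewrite (tensor_id (mc_monoidal C)) /= !comp_idr comp_idl.
- by rewrite /= comp_idl comp_idr.
Defined.

Definition endo_data : mon_data :=
  @MonData endo_cat seq_strong mon_nat_seq id_strong
    endo_alpha endo_lam endo_rho.

Definition endo_alpha_inv (F G H : strong_functor C C) :
  mon_nat (seq_strong (seq_strong F G) H) (seq_strong F (seq_strong G H)).
Proof.
refine (@MonNat C C (seq_strong (seq_strong F G) H)
  (seq_strong F (seq_strong G H)) (fun A => idm (H (G (F A)))) _ _ _).
- by move=> A B f; rewrite comp_idl comp_idr.
- move=> A B; rewrite seq_identity_phi (tensor_id (mc_monoidal C)).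
  by rewrite comp_idl comp_idr.
- by rewrite seq_identity_phi0 comp_idl.
Defined.

Definition endo_lam_inv (F : strong_functor C C) :
  mon_nat (seq_strong id_strong F) F.
Proof.
refine (@MonNat C C (seq_strong id_strong F) F (fun A => idm (F A)) _ _ _).
- by move=> A B f; rewrite comp_idl comp_idr.
- move=> A B; rewrite (tensor_id (mc_monoidal C)) /= fmap_id.
  by rewrite !comp_idl comp_idr.
- by rewrite /= fmap_id !comp_idl.
Defined.

Definition endo_rho_inv (F : strong_functor C C) :
  mon_nat F (seq_strong F id_strong).
Proof.
refine (@MonNat C C F (seq_strong F id_strong) (fun A => idm (F A)) _ _ _).
- by move=> A B f; rewrite comp_idl comp_idr.
- by move=> A B; rewrite (tensor_id (mc_monoidal C)) /= !comp_idr comp_idl.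
- by rewrite /= comp_idl comp_idr.
Defined.

Lemma endo_monoidal : is_monoidal endo_data.
Proof.
split.
- by move=> F G; apply: mon_nat_eq => A /=; rewrite fmap_id comp_idl.
- move=> F F' F'' G G' G'' s' s t' t; apply: mon_nat_eq => A /=.
  rewrite fmap_comp !comp_assoc; congr (_ ∘ _).
  by rewrite -!comp_assoc component_natural.
- move=> F F' G G' H H' s t u; apply: mon_nat_eq => A /=.
  by rewrite comp_idl comp_idr fmap_comp comp_assoc.
- by move=> F G s; apply: mon_nat_eq => A /=; rewrite fmap_id comp_idl !comp_idr.
- by move=> F G s; apply: mon_nat_eq => A /=; rewrite !comp_idl comp_idr.
- move=> F G H; exists (endo_alpha_inv F G H).
  by split; apply: mon_nat_eq => A /=; rewrite comp_idl.
- move=> F; exists (endo_lam_inv F).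
  by split; apply: mon_nat_eq => A /=; rewrite comp_idl.
- move=> F; exists (endo_rho_inv F).
  by split; apply: mon_nat_eq => A /=; rewrite comp_idl.
- by move=> F G H K; apply: mon_nat_eq => A /=; rewrite !fmap_id !comp_idl.
- by move=> F G; apply: mon_nat_eq => A /=; rewrite !fmap_id !comp_idl.
Qed.

Definition endo : monoidal_category := MonoidalCategory endo_monoidal.

End EndofunctorCategory.

Definition strong_action (X C : monoidal_category) : Type :=
  strong_functor X (endo C).

Section Action.
Variables (X C : monoidal_category) (Gam : strong_action X C).

Definition act (x : X) : strong_functor C C := fob (sf_functor Gam) x.

Definition act_mor (x y : X) (f : x ~> y) : mon_nat (act x) (act y) :=
  fmap (sf_functor Gam) f.

Definition psi (x y : X) : mon_nat (act (x ⊗ y)) (seq_strong (act x) (act y)) :=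
  phi_inv Gam x y.

Definition psi0 : mon_nat (act (tunit X)) (id_strong C) := phi0_inv Gam.

End Action.

Definition prod_cat (C D : category) : category.
Proof.
refine (@Category (ob C * ob D)%type
  (fun P Q => ((fst P ~> fst Q) * (snd P ~> snd Q))%type)
  (fun P => (idm (fst P), idm (snd P)))
  (fun P Q R g f => (fst g ∘ fst f, snd g ∘ snd f)) _ _ _).
- by move=> P Q [f1 f2] /=; rewrite !comp_idl.
- by move=> P Q [f1 f2] /=; rewrite !comp_idr.
- by move=> P Q R S [h1 h2] [g1 g2] [f1 f2] /=; rewrite !comp_assoc.
Defined.

Section Semidirect.
Variables (X C : monoidal_category) (Gam : strong_action X C).
Local Notation XC := (prod_cat X C).

Definition sd_ob (P Q : XC) : XC :=
  (fst P ⊗ fst Q, act Gam (fst Q) (snd P) ⊗ snd Q).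

(* The C-component is g^h ⊗ k for P = (f, g) and Q = (h, k), where g^h is the
   diagonal of the naturality square of (-)^h at g. *)
Definition sd_mor (P P' Q Q' : XC) (p : P ~> P') (q : Q ~> Q') :
    sd_ob P Q ~> sd_ob P' Q' :=
  (fst p ⊗₁ fst q,
   (act_mor Gam (fst q) (snd P') ∘ fmap (act Gam (fst Q)) (snd p))
     ⊗₁ snd q).

Definition sd_unit : XC := (tunit X, tunit C).

Definition sd_alpha (P Q R : XC) :
    sd_ob P (sd_ob Q R) ~> sd_ob (sd_ob P Q) R :=
  let: (x, A) := P in let: (y, B) := Q in let: (z, D) := R in
  (alpha x y z,
   (phi (act Gam z) (act Gam y A) B ⊗₁ idm D)
     ∘ alpha (act Gam z (act Gam y A)) (act Gam z B) D
     ∘ (psi Gam y z A ⊗₁ idm (act Gam z B ⊗ D))).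

Definition sd_lam (P : XC) : P ~> sd_ob sd_unit P :=
  let: (x, A) := P in
  (lam x, (phi0 (act Gam x) ⊗₁ idm A) ∘ lam A).

Definition sd_rho (P : XC) : sd_ob P sd_unit ~> P :=
  let: (x, A) := P in
  (rho x, rho A ∘ (psi0 Gam A ⊗₁ idm (tunit C))).

Definition semidirect : mon_data :=
  @MonData XC sd_ob sd_mor sd_unit sd_alpha sd_lam sd_rho.

End Semidirect.

(* Main.v *)
(* The C-components of the axioms for the semidirect product follow from those
   of C by moving each [psi] to the right past [phi] and [alpha]: what
   is then left over is the associativity and unitality of Gam, evaluated at an
   object of C, and the monoidality of the transformation [psi]. *)
From Stdlib Require Import ssreflect.
Require Import Defs.

Set Implicit Arguments.
Unset Strict Implicit.
Unset Printing Implicit Defensive.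
Local Open Scope cat_scope.

(** * Isomorphisms and cancellation in categories and their products *)

Section Category.
Variable C : category.

Lemma is_iso_id (A : C) : is_iso (idm A).
Proof. by exists (idm A); split; rewrite comp_idl. Qed.

Lemma is_iso_comp (A B E : C) (g : B ~> E) (f : A ~> B) :
  is_iso g -> is_iso f -> is_iso (g ∘ f).
Proof.
move=> [g' [g1 g2]] [f' [f1 f2]]; exists (f' ∘ g'); split.
  by rewrite -comp_assoc (comp_assoc g') g1 comp_idl.
by rewrite -comp_assoc (comp_assoc f) f2 comp_idl.
Qed.

(** In a composite bracketed to the left, [g ∘ f] is not a subterm of [h ∘ g ∘ f]; this form
    rewrites it there without reassociating. *)
Lemma comp_eqr (A B B' E E' : C) (f : A ~> B) (g : B ~> E) (f' : A ~> B')
    (g' : B' ~> E) (h : E ~> E') :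
  g ∘ f = g' ∘ f' -> h ∘ g ∘ f = h ∘ g' ∘ f'.
Proof. by move=> e; rewrite -!comp_assoc e. Qed.

Lemma inverse_sym (A B : C) (f : A ~> B) (g : B ~> A) :
  inverse f g -> inverse g f.
Proof. by case. Qed.

(** With [comp_inversel], turns axioms on the lax maps of an action into equations on their oplax
    inverses. *)
Lemma comp_inverser (A B E : C) (f : A ~> B) (g : B ~> A) (h : B ~> E)
    (k : A ~> E) :
  inverse f g -> h ∘ f = k -> h = k ∘ g.
Proof. by move=> [_ fg] <-; rewrite -comp_assoc fg comp_idr. Qed.

Lemma comp_inversel (A B E : C) (f : A ~> B) (g : B ~> A) (h : E ~> A)
    (k : E ~> B) :
  inverse f g -> f ∘ h = k -> h = g ∘ k.
Proof. by move=> [gf _] <-; rewrite comp_assoc gf comp_idl. Qed.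

End Category.

Lemma prod_hom_eq (C D : category) (P Q : prod_cat C D) (f g : P ~> Q) :
  fst f = fst g -> snd f = snd g -> f = g.
Proof. by case: f g => [f1 f2] [g1 g2] /= -> ->. Qed.

Lemma fmap_inverse (C D : category) (F : functor C D) (A B : C) (f : A ~> B)
    (g : B ~> A) :
  inverse f g -> inverse (fmap F f) (fmap F g).
Proof. by case=> gf fg; split; rewrite -fmap_comp ?gf ?fg fmap_id. Qed.

Lemma is_iso_pair (C D : category) (P Q : prod_cat C D) (f : P ~> Q) :
  is_iso (fst f) -> is_iso (snd f) -> is_iso f.
Proof.
case: f => f g /= [f' [f1 f2]] [g' [g1 g2]].
by exists ((f', g') : Q ~> P); split; congr pair.
Qed.

(** * Tensoring with an identity in a monoidal category *)

Section Tensor.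
Variable C : monoidal_category.

Lemma is_iso_tensor (A A' B B' : C) (f : A ~> A') (g : B ~> B') :
  is_iso f -> is_iso g -> is_iso (f ⊗₁ g).
Proof.
move=> [f' [f1 f2]] [g' [g1 g2]]; exists (f' ⊗₁ g').
by split; rewrite -(tensor_comp (mc_monoidal C)) ?f1 ?f2 ?g1 ?g2
  (tensor_id (mc_monoidal C)).
Qed.

Lemma tensor_compl (A A' A'' B : C) (g : A' ~> A'') (f : A ~> A') :
  (g ∘ f) ⊗₁ idm B = (g ⊗₁ idm B) ∘ (f ⊗₁ idm B).
Proof. by rewrite -(tensor_comp (mc_monoidal C)) comp_idl. Qed.

Lemma tensor_compr (A B B' B'' : C) (g : B' ~> B'') (f : B ~> B') :
  idm A ⊗₁ (g ∘ f) = (idm A ⊗₁ g) ∘ (idm A ⊗₁ f).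
Proof. by rewrite -(tensor_comp (mc_monoidal C)) comp_idl. Qed.

Lemma alpha_naturall (A A' B D : C) (f : A ~> A') :
  alpha A' B D ∘ (f ⊗₁ idm (B ⊗ D)) = ((f ⊗₁ idm B) ⊗₁ idm D) ∘ alpha A B D.
Proof.
by rewrite -(alpha_natural (mc_monoidal C)) (tensor_id (mc_monoidal C)).
Qed.

End Tensor.

(** * Interaction of [phi] with associators *)

Section StrongFunctor.
Variables (C D : monoidal_category) (F : strong_functor C D).

Lemma phi_naturall (A A' B : C) (f : A ~> A') :
  fmap F (f ⊗₁ idm B) ∘ phi F A B
  = phi F A' B ∘ (fmap F f ⊗₁ idm (F B)).
Proof. by rewrite -phi_natural fmap_id. Qed.

(** [C] acts on [D] by tensoring with [F A], with associator [(phi ⊗₁ idm) ∘ alpha]. This is the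
    pentagon of that action; it combines [phi_alpha] with the pentagon of [D]. *)
Lemma phi_pentagon (A B G : C) (E : D) :
  (fmap F (alpha A B G) ⊗₁ idm E) ∘ ((phi F A (B ⊗ G) ⊗₁ idm E)
    ∘ (alpha (F A) (F (B ⊗ G)) E
    ∘ (idm (F A) ⊗₁ ((phi F B G ⊗₁ idm E) ∘ alpha (F B) (F G) E))))
  = ((phi F (A ⊗ B) G ⊗₁ idm E) ∘ alpha (F (A ⊗ B)) (F G) E)
    ∘ ((phi F A B ⊗₁ idm (F G ⊗ E)) ∘ alpha (F A) (F B) (F G ⊗ E)).
Proof.
rewrite tensor_compr !comp_assoc.
rewrite (comp_eqr _ (alpha_natural (mc_monoidal D) _ _ _)).
rewrite -!tensor_compl phi_alpha !tensor_compl.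
rewrite (comp_eqr _ (alpha_naturall _ _ _)) -!comp_assoc.
by rewrite (pentagon (mc_monoidal D)) -!comp_assoc.
Qed.

(** Naturality of the same associator in its first argument; it carries images under [F] to the
    right past [phi] and [alpha]. *)
Lemma phi_alpha_naturall (A A' B : C) (E : D) (f : A ~> A') :
  (fmap F (f ⊗₁ idm B) ⊗₁ idm E) ∘ ((phi F A B ⊗₁ idm E)
    ∘ alpha (F A) (F B) E)
  = (phi F A' B ⊗₁ idm E) ∘ alpha (F A') (F B) E
    ∘ (fmap F f ⊗₁ idm (F B ⊗ E)).
Proof.
rewrite comp_assoc -tensor_compl phi_naturall tensor_compl -!comp_assoc.
by rewrite alpha_naturall.
Qed.

End StrongFunctor.

(** * The axioms of the action, evaluated at an object and put in oplax form *)

Section ActionComponents.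
Variables (X C : monoidal_category) (Gam : strong_action X C).

(* These retype [psi] and [psi0] so that the functors [seq_strong _ _] and
   [id_strong C], equal to the displayed ones only up to conversion, do not
   obstruct rewriting. *)
Definition psi_at (x y : X) (A : C) :
  act Gam (x ⊗ y) A ~> act Gam y (act Gam x A) := psi Gam x y A.

Definition psi0_at (A : C) : act Gam (tunit X) A ~> A := psi0 Gam A.

Lemma act_mor_id (x : X) (A : C) : act_mor Gam (idm x) A = idm (act Gam x A).
Proof. by rewrite /act_mor fmap_id. Qed.

Lemma act_mor_comp (x y z : X) (g : y ~> z) (f : x ~> y) (A : C) :
  act_mor Gam (g ∘ f) A = act_mor Gam g A ∘ act_mor Gam f A.
Proof. by rewrite /act_mor fmap_comp. Qed.

(** The axioms of [strong_functor] constrain these lax maps; the laws of [psi_at] follow by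
    inversion. *)
Definition phi_at (x y : X) (A : C) :
  act Gam y (act Gam x A) ~> act Gam (x ⊗ y) A :=
  (phi Gam x y : mon_nat _ _) A.

Definition phi0_at (A : C) : A ~> act Gam (tunit X) A :=
  (phi0 Gam : mon_nat _ _) A.

Lemma psi_atK (x y : X) (A : C) : inverse (psi_at x y A) (phi_at x y A).
Proof.
by case: (phiK Gam x y) => e1 e2; split;
  [have := f_equal (fun t : mon_nat _ _ => t A) e2
  |have := f_equal (fun t : mon_nat _ _ => t A) e1].
Qed.

Lemma psi0_atK (A : C) : inverse (psi0_at A) (phi0_at A).
Proof.
by case: (phi0K Gam) => e1 e2; split;
  [have := f_equal (fun t : mon_nat _ _ => t A) e2
  |have := f_equal (fun t : mon_nat _ _ => t A) e1].
Qed.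

Lemma psi_iso (x y : X) (A : C) : is_iso (psi_at x y A).
Proof. by exists (phi_at x y A); apply: psi_atK. Qed.

Lemma psi0_iso (A : C) : is_iso (psi0_at A).
Proof. by exists (phi0_at A); apply: psi0_atK. Qed.

Lemma psi_natural (x y : X) (A B : C) (a : A ~> B) :
  psi_at x y B ∘ fmap (act Gam (x ⊗ y)) a
  = fmap (act Gam y) (fmap (act Gam x) a) ∘ psi_at x y A.
Proof. exact: (component_natural (psi Gam x y)). Qed.

Lemma psi0_natural (A B : C) (a : A ~> B) :
  psi0_at B ∘ fmap (act Gam (tunit X)) a = a ∘ psi0_at A.
Proof. exact: (component_natural (psi0 Gam)). Qed.

(** Monoidality of [psi]; the two [phi] on the right compose to that of the composite functor. *)
Lemma psi_phi (x y : X) (A B : C) :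
  psi_at x y (A ⊗ B) ∘ phi (act Gam (x ⊗ y)) A B
  = fmap (act Gam y) (phi (act Gam x) A B)
      ∘ phi (act Gam y) (act Gam x A) (act Gam x B)
      ∘ (psi_at x y A ⊗₁ psi_at x y B).
Proof. exact: (component_phi (psi Gam x y)). Qed.

(** Naturality of the lax map of [Gam] at [A], transposed along the inverses. *)
Lemma psi_act_mor (x x' y y' : X) (f : x ~> x') (g : y ~> y') (A : C) :
  psi_at x' y' A ∘ act_mor Gam (f ⊗₁ g) A
  = act_mor Gam g (act Gam x' A) ∘ fmap (act Gam y) (act_mor Gam f A)
      ∘ psi_at x y A.
Proof.
have e : phi_at x' y' A
    ∘ (act_mor Gam g (act Gam x' A) ∘ fmap (act Gam y) (act_mor Gam f A))
  = act_mor Gam (f ⊗₁ g) A ∘ phi_at x y A.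
  exact: (f_equal (fun t : mon_nat _ _ => t A) (phi_natural Gam f g)).
symmetry; apply: comp_inversel (inverse_sym (psi_atK x' y' A)) _.
rewrite comp_assoc e -comp_assoc.
by case: (psi_atK x y A) => -> _; rewrite comp_idr.
Qed.

(** The associativity axiom of [Gam] at [A] with its four lax maps inverted; the associator of
    [endo C] has identity components. *)
Lemma psi_alpha (x y z : X) (A : C) :
  fmap (act Gam z) (psi_at x y A) ∘ psi_at (x ⊗ y) z A
    ∘ act_mor Gam (alpha x y z) A
  = psi_at y z (act Gam x A) ∘ psi_at x (y ⊗ z) A.
Proof.
(* The identities come from the tensor factors and the associator in [phi_alpha]; keeping them makes
   the equation hold by conversion. *)
have e : act_mor Gam (alpha x y z) A ∘ phi_at x (y ⊗ z) A
    ∘ (phi_at y z (act Gam x A)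
        ∘ fmap (act Gam z) (fmap (act Gam y) (idm (act Gam x A))))
  = phi_at (x ⊗ y) z A ∘ (idm _ ∘ fmap (act Gam z) (phi_at x y A)) ∘ idm _.
  exact: (f_equal (fun t : mon_nat _ _ => t A) (phi_alpha Gam x y z)).
rewrite !fmap_id !comp_idr comp_idl in e.
have {}e := comp_inverser (inverse_sym (psi_atK y z (act Gam x A))) e.
have {}e := comp_inverser (inverse_sym (psi_atK x (y ⊗ z) A)) e.
rewrite -!comp_assoc in e *; symmetry.
apply: comp_inversel (fmap_inverse _ (inverse_sym (psi_atK x y A))) _.
by apply: comp_inversel (inverse_sym (psi_atK (x ⊗ y) z A)) _; rewrite e.
Qed.

(** The left unit axiom of [Gam] writes [act_mor Gam (lam x) A] through lax maps, which [psi_at] and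
    [psi0_at] cancel. *)
Lemma psi_lam (x : X) (A : C) :
  fmap (act Gam x) (psi0_at A) ∘ psi_at (tunit X) x A ∘ act_mor Gam (lam x) A
  = idm (act Gam x A).
Proof.
have e : phi_at (tunit X) x A ∘ (idm _ ∘ fmap (act Gam x) (phi0_at A)) ∘ idm _
  = act_mor Gam (lam x) A.
  exact: (f_equal (fun t : mon_nat _ _ => t A) (phi_lam Gam x)).
rewrite comp_idr comp_idl in e.
rewrite -e -comp_assoc (comp_assoc (psi_at _ _ _)).
case: (psi_atK (tunit X) x A) => _ ->; rewrite comp_idl -fmap_comp.
by case: (psi0_atK A) => _ ->; rewrite fmap_id.
Qed.

End ActionComponents.

(** * The [C]-components of naturality of the associator, pentagon and triangle *)

Section SemidirectCoherence.
Variables (X C : monoidal_category) (Gam : strong_action X C).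

Lemma semidirect_alpha_natural (x y z y' z' : X) (A B D A' B' D' : C)
    (a : A ~> A') (b : B ~> B') (d : D ~> D') (g : y ~> y') (h : z ~> z') :
  (phi (act Gam z') (act Gam y' A') B' ⊗₁ idm D')
    ∘ alpha (act Gam z' (act Gam y' A')) (act Gam z' B') D'
    ∘ (psi_at Gam y' z' A' ⊗₁ idm (act Gam z' B' ⊗ D'))
    ∘ ((act_mor Gam (g ⊗₁ h) A' ∘ fmap (act Gam (y ⊗ z)) a)
         ⊗₁ ((act_mor Gam h B' ∘ fmap (act Gam z) b) ⊗₁ d))
  = ((act_mor Gam h (act Gam y' A' ⊗ B')
        ∘ fmap (act Gam z) ((act_mor Gam g A' ∘ fmap (act Gam y) a) ⊗₁ b))
       ⊗₁ d)
    ∘ ((phi (act Gam z) (act Gam y A) B ⊗₁ idm D)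
    ∘ alpha (act Gam z (act Gam y A)) (act Gam z B) D
    ∘ (psi_at Gam y z A ⊗₁ idm (act Gam z B ⊗ D))).
Proof.
rewrite -comp_assoc -(tensor_comp (mc_monoidal C)) comp_idl.
rewrite comp_assoc psi_act_mor -!comp_assoc psi_natural.
rewrite (comp_assoc (fmap _ _) (fmap _ _)) -fmap_comp.
rewrite (comp_assoc (act_mor _ _ _) (fmap _ _)).
(* The inserted identity splits off [psi_at], leaving a triple tensor to which naturality of [alpha]
   applies. *)
rewrite -{1}(comp_idr (_ ⊗₁ d)) (tensor_comp (mc_monoidal C)).
rewrite (comp_assoc (alpha _ _ _)) (alpha_natural (mc_monoidal C)).
rewrite !comp_assoc -!(tensor_comp (mc_monoidal C)) comp_idl comp_idr.
(* Here [(-)^h] is used as a monoidal transformation. *)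
rewrite -(comp_assoc (act_mor _ _ _)) -phi_natural !comp_assoc component_phi.
by rewrite -(comp_assoc (phi _ _ _)) -(tensor_comp (mc_monoidal C)).
Qed.

Lemma semidirect_pentagon (y z w : X) (A B D E : C) :
  (phi (act Gam w) (act Gam z (act Gam y A ⊗ B)) D ⊗₁ idm E)
    ∘ alpha (act Gam w (act Gam z (act Gam y A ⊗ B))) (act Gam w D) E
    ∘ (psi_at Gam z w (act Gam y A ⊗ B) ⊗₁ idm (act Gam w D ⊗ E))
    ∘ ((phi (act Gam (z ⊗ w)) (act Gam y A) B ⊗₁ idm (act Gam w D ⊗ E))
    ∘ alpha (act Gam (z ⊗ w) (act Gam y A)) (act Gam (z ⊗ w) B) (act Gam w D ⊗ E)
    ∘ (psi_at Gam y (z ⊗ w) A ⊗₁ idm (act Gam (z ⊗ w) B ⊗ (act Gam w D ⊗ E))))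
  = (fmap (act Gam w)
       ((phi (act Gam z) (act Gam y A) B ⊗₁ idm D)
          ∘ alpha (act Gam z (act Gam y A)) (act Gam z B) D
          ∘ (psi_at Gam y z A ⊗₁ idm (act Gam z B ⊗ D))) ⊗₁ idm E)
    ∘ ((phi (act Gam w) (act Gam (y ⊗ z) A) (act Gam z B ⊗ D) ⊗₁ idm E)
    ∘ alpha (act Gam w (act Gam (y ⊗ z) A)) (act Gam w (act Gam z B ⊗ D)) E
    ∘ (psi_at Gam (y ⊗ z) w A ⊗₁ idm (act Gam w (act Gam z B ⊗ D) ⊗ E)))
    ∘ (act_mor Gam (alpha y z w) A
         ⊗₁ ((phi (act Gam w) (act Gam z B) D ⊗₁ idm E)
               ∘ alpha (act Gam w (act Gam z B)) (act Gam w D) E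
               ∘ (psi_at Gam z w B ⊗₁ idm (act Gam w D ⊗ E)))).
Proof.
symmetry.
rewrite !fmap_comp !tensor_compl.
rewrite -(comp_assoc _ _ (_ ⊗₁ (_ ∘ _))) -!(comp_assoc _ (fmap _ _ ⊗₁ _)).
rewrite 2!(comp_assoc (fmap _ (psi_at _ _ _ _ ⊗₁ _) ⊗₁ _)) phi_alpha_naturall.
rewrite -!comp_assoc -!(tensor_comp (mc_monoidal C)) !comp_idl.
(* All action maps on [A] now stand in one tensor factor, where associativity of [Gam] applies. *)
rewrite (comp_assoc (fmap _ _)) psi_alpha.
rewrite (comp_assoc (_ ⊗₁ _) (alpha _ _ _) (psi_at _ _ _ B ⊗₁ _)).
rewrite -(comp_idl (psi_at _ _ _ _ ∘ psi_at _ _ _ _)).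
rewrite (tensor_comp (mc_monoidal C)).
rewrite -(comp_idr (psi_at _ _ _ B ⊗₁ _)) (tensor_comp (mc_monoidal C)).
rewrite (comp_assoc (alpha _ _ _) (idm _ ⊗₁ _)).
rewrite (comp_assoc _ (_ ∘ (idm _ ⊗₁ _))).
(* With [psi_at] split off on the right, the pentagon applies to [(-)^w]. *)
rewrite (comp_assoc _ (_ ∘ (_ ∘ (idm _ ⊗₁ _)))) phi_pentagon.
rewrite 2!(comp_assoc (fmap _ _ ⊗₁ _)) phi_alpha_naturall !comp_assoc.
rewrite (comp_eqr _ (alpha_natural (mc_monoidal C) _ _ _)).
rewrite -(comp_assoc _ (fmap _ _ ⊗₁ _)) -tensor_compl.
(* Monoidality of [psi] merges the [phi] of [(-)^z] and [(-)^w] into that of [(-)^(z ⊗ w)]. *)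
rewrite -(comp_assoc _ (_ ⊗₁ _) ((_ ⊗₁ _) ⊗₁ _)) -tensor_compl -psi_phi.
by rewrite tensor_compl !comp_assoc.
Qed.

Lemma semidirect_triangle (y : X) (A B : C) :
  (fmap (act Gam y) (rho A ∘ (psi0_at Gam A ⊗₁ idm (tunit C))) ⊗₁ idm B)
    ∘ ((phi (act Gam y) (act Gam (tunit X) A) (tunit C) ⊗₁ idm B)
    ∘ alpha (act Gam y (act Gam (tunit X) A)) (act Gam y (tunit C)) B
    ∘ (psi_at Gam (tunit X) y A ⊗₁ idm (act Gam y (tunit C) ⊗ B)))
    ∘ (act_mor Gam (lam y) A ⊗₁ ((phi0 (act Gam y) ⊗₁ idm B) ∘ lam B))
  = idm (act Gam y A ⊗ B).
Proof.
rewrite fmap_comp tensor_compl.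
rewrite -(comp_assoc _ _ (_ ⊗₁ (_ ∘ _))) -(comp_assoc _ (fmap _ _ ⊗₁ _)).
rewrite 2!(comp_assoc (fmap _ (_ ⊗₁ _) ⊗₁ _)) phi_alpha_naturall.
rewrite -!comp_assoc -!(tensor_comp (mc_monoidal C)) !comp_idl.
rewrite (comp_assoc (fmap _ _)) psi_lam tensor_compr !comp_assoc.
rewrite (comp_eqr _ (alpha_natural (mc_monoidal C) _ _ _)).
(* The right unit axiom of [(-)^y] leaves the triangle of [C]. *)
rewrite -!tensor_compl phi_rho.
exact: triangle (mc_monoidal C) _ _.
Qed.

End SemidirectCoherence.

(** * Verification of the axioms, one component at a time *)

Theorem theorem5p2 (X C : monoidal_category) (Gam : strong_action X C) :
  is_monoidal (semidirect Gam).
Proof.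
split.
- move=> [x A] [y B]; apply: prod_hom_eq => /=.
    exact: tensor_id (mc_monoidal X) _ _.
  by rewrite act_mor_id fmap_id comp_idl (tensor_id (mc_monoidal C)).
- move=> [x A] [x' A'] [x'' A''] [y B] [y' B'] [y'' B''].
  move=> [f' a'] [f a] [g' b'] [g b]; apply: prod_hom_eq => /=.
    exact: tensor_comp (mc_monoidal X) _ _ _ _ _ _ _ _ _ _.
  rewrite -(tensor_comp (mc_monoidal C)) act_mor_comp fmap_comp.
  rewrite -!comp_assoc; congr (_ ⊗₁ _); congr (_ ∘ _).
  (* What remains is naturality of [(-)^g] at [a']. *)
  by rewrite !comp_assoc component_natural.
- move=> [x A] [x' A'] [y B] [y' B'] [z D] [z' D'] [f a] [g b] [h d].
  apply: prod_hom_eq => /=.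
    exact: alpha_natural (mc_monoidal X) _ _ _ _ _ _ _ _ _.
  exact: semidirect_alpha_natural.
- move=> [x A] [x' A'] [f a]; apply: prod_hom_eq => /=.
    exact: lam_natural (mc_monoidal X) _ _ _.
  rewrite fmap_id comp_idr -comp_assoc (lam_natural (mc_monoidal C)).
  by rewrite !comp_assoc -!(tensor_comp (mc_monoidal C)) component_phi0
    comp_idl !comp_idr.
- move=> [x A] [x' A'] [f a]; apply: prod_hom_eq => /=.
    exact: rho_natural (mc_monoidal X) _ _ _.
  rewrite act_mor_id comp_idl -!comp_assoc -tensor_compl.
  rewrite (psi0_natural Gam) tensor_compl comp_assoc.
  by rewrite (rho_natural (mc_monoidal C)) comp_assoc.
- move=> [x A] [y B] [z D]; apply: is_iso_pair => /=.
    exact: alpha_iso (mc_monoidal X) _ _ _.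
  apply: is_iso_comp; first apply: is_iso_comp.
  + apply: is_iso_tensor; last exact: is_iso_id.
    by exists (phi_inv (act Gam z) (act Gam y A) B); apply: phiK.
  + exact: alpha_iso (mc_monoidal C) _ _ _.
  + by apply: is_iso_tensor; [exact: psi_iso | exact: is_iso_id].
- move=> [x A]; apply: is_iso_pair => /=.
    exact: lam_iso (mc_monoidal X) _.
  apply: is_iso_comp; last exact: lam_iso (mc_monoidal C) _.
  apply: is_iso_tensor; last exact: is_iso_id.
  by exists (phi0_inv (act Gam x)); apply: phi0K.
- move=> [x A]; apply: is_iso_pair => /=.
    exact: rho_iso (mc_monoidal X) _.
  apply: is_iso_comp; first exact: rho_iso (mc_monoidal C) _.
  by apply: is_iso_tensor; [exact: psi0_iso | exact: is_iso_id].
- move=> [x A] [y B] [z D] [w E]; apply: prod_hom_eq => /=.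
    exact: pentagon (mc_monoidal X) _ _ _ _.
  rewrite act_mor_id comp_idl fmap_id comp_idr.
  exact: semidirect_pentagon.
- move=> [x A] [y B]; apply: prod_hom_eq => /=.
    exact: triangle (mc_monoidal X) _ _.
  rewrite act_mor_id comp_idl fmap_id comp_idr.
  exact: semidirect_triangle.
Qed.
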